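(* Let $\mathbb{K}=\mathbb{R}$ or $\mathbb{K}=\mathbb{C}$, let $W\in\mathbb{K}^{m\times n}$, and let $X\in\mathbb{K}^{n\times m}$ satisfy $XWW^*WX=W^*$. Then $$(WX)^2=P_{\mathcal{C}(W)},\quad (XW)^2=P_{\mathcal{C}(W^* )},$$ $$(WX)^3=WX,\quad (XW)^3=XW.$$
   Context: $W^*$ denotes the conjugate transpose (transpose over $\mathbb{R}$), $\mathcal{C}(A)$ the column space of $A$, and $P_{\mathcal{S}}$ the orthogonal projection matrix onto a subspace $\mathcal{S}$. *)

(* Defs.v *)
From mathcomp Require Import all_boot all_order all_algebra.
From mathcomp Require Import reals.
From mathcomp Require Import complex.

Set Implicit Arguments.
Unset Strict Implicit.
Unset Printing Implicit Defensive.

Import Order.TTheory GRing.Theory Num.Theory.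
Local Open Scope ring_scope.

Inductive scalar_kind := RealScalars | ComplexScalars.

Definition scalars (R : realType) (k : scalar_kind) : numFieldType :=
  match k with
  | RealScalars => R
  | ComplexScalars => R[i]
  end.

Definition conjs (R : realType) (k : scalar_kind) : scalars R k -> scalars R k :=
  match k with
  | RealScalars => id
  | ComplexScalars => @conjc R
  end.

Definition adjmx (R : realType) (k : scalar_kind) (m n : nat)
    (W : 'M[scalars R k]_(m, n)) : 'M[scalars R k]_(n, m) :=
  map_mx (@conjs R k) W^T.

Definition colspace (F : fieldType) (m n : nat) (W : 'M[F]_(m, n)) :
    {vspace 'cV[F]_m} :=
  (<<[seq col j W | j <- enum 'I_n]>>)%VS.

(* A vector is orthogonal to S as soon as it is orthogonal to a basis of S;
   see [orthcomplP]. *)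
Definition orthcompl (R : realType) (k : scalar_kind) (m : nat)
    (S : {vspace 'cV[scalars R k]_m}) : {vspace 'cV[scalars R k]_m} :=
  (\bigcap_(u <- vbasis S) lker (linfun (mulmx (adjmx u))))%VS.

(* The matrix, in the standard basis and acting on column vectors, of the
   projection onto S along its orthogonal complement; see [orthprojP] and
   [orthproj_unique]. *)
Definition orthproj (R : realType) (k : scalar_kind) (m : nat)
    (S : {vspace 'cV[scalars R k]_m}) : 'M[scalars R k]_m :=
  \matrix_(i, j) (daddv_pi S (orthcompl S) (delta_mx j 0 : 'cV_m)) i 0.

Section Adequacy.
Variables (R : realType) (k : scalar_kind).
Local Notation K := (scalars R k).

Lemma conjsD (x y : K) : conjs (x + y) = conjs x + conjs y.
Proof. by case: k x y => x y //=; exact: rmorphD. Qed.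

Lemma conjsM (x y : K) : conjs (x * y) = conjs x * conjs y.
Proof. by case: k x y => x y //=; exact: rmorphM. Qed.

Lemma conjs0 : conjs (0 : K) = 0.
Proof. by case: k => //=; exact: (raddf0 (@conjc R)). Qed.

Lemma conjs_mul_ge0 (x : K) : 0 <= conjs x * x.
Proof.
case: k x => x /=; first by rewrite -expr2; exact: sqr_ge0.
by rewrite mulrC -[conjc x]/(Num.conj x) -normCK; exact: exprn_ge0.
Qed.

Lemma conjs_mul_eq0 (x : K) : conjs x * x = 0 -> x = 0.
Proof.
case: k x => x /=; first by move/eqP; rewrite mulf_eq0 orbb => /eqP.
rewrite mulrC -[conjc x]/(Num.conj x) -normCK => /eqP.
by rewrite expf_eq0 /= normr_eq0 => /eqP.
Qed.

Lemma adjmx_dotD m (u v w : 'cV[K]_m) :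
  adjmx (u + v) *m w = adjmx u *m w + adjmx v *m w.
Proof.
by rewrite -mulmxDl; congr (_ *m _); apply/matrixP => i j; rewrite !mxE conjsD.
Qed.

Lemma adjmx_dotZ m a (u w : 'cV[K]_m) :
  adjmx (a *: u) *m w = conjs a *: (adjmx u *m w).
Proof.
by rewrite scalemxAl; congr (_ *m _); apply/matrixP => i j; rewrite !mxE conjsM.
Qed.

Lemma adjmx_dot_eq0 m (u : 'cV[K]_m) : adjmx u *m u = 0 -> u = 0.
Proof.
move=> /matrixP/(_ 0 0); rewrite !mxE => /eqP.
rewrite psumr_eq0 => [/allP u0|i _]; last by rewrite !mxE conjs_mul_ge0.
apply/matrixP => i j; rewrite (ord1 j) [RHS]mxE; apply: conjs_mul_eq0.
by have := u0 i (mem_index_enum i); rewrite /= !mxE => /eqP.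
Qed.

Lemma memv_orthcompl m (S : {vspace 'cV[K]_m}) (v : 'cV[K]_m) :
  (v \in orthcompl S) = all (fun u => adjmx u *m v == 0) (vbasis S).
Proof.
rewrite /orthcompl; elim: (tval _) => [|u s IHs]; first by rewrite big_nil memvf.
by rewrite big_cons memv_cap IHs memv_ker lfunE.
Qed.

Lemma orthcomplP m (S : {vspace 'cV[K]_m}) (v : 'cV[K]_m) :
  reflect (forall u, u \in S -> adjmx u *m v = 0) (v \in orthcompl S).
Proof.
rewrite memv_orthcompl; apply: (iffP allP) => [h u uS|h u uS]; last first.
  by apply/eqP/h/vbasis_mem.
rewrite (coord_vbasis uS).
elim/big_rec: _ => [|i w _ w0].
  have -> : adjmx (0 : 'cV[K]_m) = 0.
    by apply/matrixP => i j; rewrite !mxE conjs0.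
  by rewrite mul0mx.
rewrite adjmx_dotD w0 addr0 adjmx_dotZ.
have /eqP -> : adjmx (vbasis S)`_i *m v == 0.
  by apply: h; rewrite mem_nth ?size_tuple.
by rewrite scaler0.
Qed.

Lemma orthcompl_disj m (S : {vspace 'cV[K]_m}) : (S :&: orthcompl S = 0)%VS.
Proof.
apply/eqP; rewrite -subv0; apply/subvP => v; rewrite memv_cap memv0.
by case/andP=> vS /orthcomplP/(_ v vS)/adjmx_dot_eq0 ->.
Qed.

Lemma orthcompl_full m (S : {vspace 'cV[K]_m}) : (S + orthcompl S = fullv)%VS.
Proof.
pose B := \matrix_(i < \dim S, j < m) conjs ((vbasis S)`_i j 0).
pose f : 'Hom('cV[K]_m, 'cV[K]_(\dim S)) := linfun (mulmx B).
have kerE : (lker f <= orthcompl S)%VS.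
  apply/subvP => v; rewrite memv_ker lfunE /= => /eqP Bv0.
  rewrite memv_orthcompl; apply/allP => u /(nthP 0)[i lt_i <-].
  rewrite size_tuple in lt_i.
  apply/eqP/matrixP => a b; rewrite (ord1 a) (ord1 b).
  have /matrixP/(_ (Ordinal lt_i) 0) := Bv0; rewrite !mxE => Bv0i.
  by rewrite -[RHS]Bv0i; apply: eq_bigr => j _; rewrite !mxE.
apply/eqP; rewrite eqEdim subvf /= dimv_disjoint_sum ?orthcompl_disj //.
have := limg_ker_dim f fullv; rewrite capfv => <-.
rewrite addnC leq_add ?dimvS //.
by apply: leq_trans (dimvS (subvf _)) _; rewrite dimvf /dim /= muln1.
Qed.

Lemma orthproj_mul m (S : {vspace 'cV[K]_m}) (v : 'cV[K]_m) :
  orthproj S *m v = daddv_pi S (orthcompl S) v.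
Proof.
have vE : v = \sum_j v j 0 *: (delta_mx j 0 : 'cV_m).
  by rewrite {1}[v]matrix_sum_delta; apply: eq_bigr => j _; rewrite big_ord1.
rewrite [in RHS]vE linear_sum /=; apply/matrixP => i j.
rewrite (ord1 j) !mxE summxE; apply: eq_bigr => l _.
by rewrite linearZ !mxE mulrC.
Qed.

Lemma orthprojP m (S : {vspace 'cV[K]_m}) (v : 'cV[K]_m) :
  orthproj S *m v \in S /\
  forall u, u \in S -> adjmx u *m (v - orthproj S *m v) = 0.
Proof.
rewrite orthproj_mul; split; first exact: memv_pi.
apply/orthcomplP.
rewrite -[X in X - _](@daddv_pi_add _ _ S (orthcompl S) v).
- by rewrite addrC addKr memv_pi.
- exact: orthcompl_disj.
- by rewrite orthcompl_full memvf.
Qed.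

Lemma orthproj_unique m (S : {vspace 'cV[K]_m}) (P : 'M[K]_m) :
  (forall v : 'cV[K]_m, P *m v \in S /\
     forall u, u \in S -> adjmx u *m (v - P *m v) = 0) ->
  P = orthproj S.
Proof.
move=> hP.
have Pv (v : 'cV[K]_m) : P *m v = orthproj S *m v.
  have [PvS Pvo] := hP v; have [QvS Qvo] := orthprojP S v.
  apply/eqP; rewrite -subr_eq0 -memv0 -(orthcompl_disj S) memv_cap.
  rewrite rpredB //=; apply/orthcomplP => u uS.
  have -> : P *m v - orthproj S *m v
      = (v - orthproj S *m v) - (v - P *m v).
    by rewrite opprB [RHS]addrC subrKA.
  by rewrite mulmxBr Pvo // Qvo // subrr.
apply/matrixP => i j.
have /matrixP/(_ i 0) := Pv (delta_mx j 0).
by rewrite -!colE !mxE.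
Qed.

End Adequacy.

(* Main.v *)
Require Import Defs.
From mathcomp Require Import all_boot all_order all_algebra.
From mathcomp Require Import reals.
From mathcomp Require Import complex.

Set Implicit Arguments.
Unset Strict Implicit.
Unset Printing Implicit Defensive.

Import Order.TTheory GRing.Theory Num.Theory.
Local Open Scope ring_scope.

(** Write B = W X and H = W W^*.  Multiplying the hypothesis by W on the left
    gives B H B = H, so that M = B H satisfies M^2 = H^2.  Hence M commutes
    with H^2, and therefore with H, because H is positive semidefinite
    ([gram_sqr_commute]).  Cancelling Gram factors turns B H H = H B H into
    B H W = H B W, whence H W = B H B W = B^2 H W, and cancelling again gives
    the central identity B^2 W = W, that is, W X W X W = W
    ([inner_inverse_sqr]).

    Multiplying it by X on the right or on the left gives the two cubic
    identities.  As for the squares, B^2 has the form W Z, and W^* B^2 = W^*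
    because W^* is a left multiple of B and B^3 = B.  Likewise (X W)^2 has the
    form Z W, and (X W)^2 W^* = W^* because W^* is a right multiple of X W and
    (X W)^3 = X W.  Either pair of properties forces the matrix to be the
    orthogonal projection onto the column space of W, resp. of W^*
    ([orthproj_colspaceP], [orthproj_colspaceP_dual]).

    That the positive root H commutes with whatever commutes with H^2 needs no
    spectral theorem: the commutator D satisfies H D + D H = 0, and the trace of
    D^* (H D + D H) is the sum of the squared Frobenius norms of W^* D
    and D W. *)

Section AdjointCalculus.
Variables (R : realType) (k : scalar_kind).
Local Notation K := (scalars R k).

Lemma conjs_sum (I : Type) (r : seq I) (P : pred I) (F : I -> K) :
  conjs (\sum_(i <- r | P i) F i) = \sum_(i <- r | P i) conjs (F i).
Proof. exact: (big_morph _ (@conjsD R k) (@conjs0 R k)). Qed.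

Lemma adjmxK (m n : nat) (A : 'M[K]_(m, n)) : adjmx (adjmx A) = A.
Proof.
apply/matrixP => i j; rewrite !mxE; move: (A i j).
by case: k => //= x; exact: conjcK.
Qed.

Lemma adjmxM (m n p : nat) (A : 'M[K]_(m, n)) (B : 'M[K]_(n, p)) :
  adjmx (A *m B) = adjmx B *m adjmx A.
Proof.
apply/matrixP => i j; rewrite !mxE conjs_sum.
by apply: eq_bigr => l _; rewrite !mxE conjsM mulrC.
Qed.

Lemma adjmx0 (m n : nat) : adjmx (0 : 'M[K]_(m, n)) = 0.
Proof. by apply/matrixP => i j; rewrite !mxE conjs0. Qed.

Lemma frobenius_ge0 (m n : nat) (A : 'M[K]_(m, n)) :
  0 <= \tr (adjmx A *m A).
Proof.
apply: sumr_ge0 => i _; rewrite mxE; apply: sumr_ge0 => j _.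
by rewrite !mxE conjs_mul_ge0.
Qed.

Lemma frobenius_eq0 (m n : nat) (A : 'M[K]_(m, n)) :
  \tr (adjmx A *m A) = 0 -> A = 0.
Proof.
have entry_ge0 i j : 0 <= adjmx A i j * A j i.
  by rewrite !mxE conjs_mul_ge0.
move=> trA0; apply/matrixP => j i; rewrite [RHS]mxE; apply: conjs_mul_eq0.
have diag0 : (adjmx A *m A) i i = 0.
  apply: (psumr_eq0P _ trA0) => // l _.
  by rewrite mxE; apply: sumr_ge0.
have := diag0; rewrite mxE => /psumr_eq0P entry0.
by have := entry0 (fun l _ => entry_ge0 i l) j isT; rewrite !mxE.
Qed.

(** The squared Frobenius norm of Y W is the trace of Y W W^* Y^*. *)
Lemma mulmx_gram_eq0 (m n p : nat) (W : 'M[K]_(m, n)) (Y : 'M[K]_(p, m)) :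
  Y *m W *m adjmx W = 0 -> Y *m W = 0.
Proof.
move=> YWW0; apply: frobenius_eq0.
by rewrite mxtrace_mulC adjmxM mulmxA YWW0 mul0mx mxtrace0.
Qed.

Lemma mulmx_gramI (m n p : nat) (W : 'M[K]_(m, n)) (Y Z : 'M[K]_(p, m)) :
  Y *m W *m adjmx W = Z *m W *m adjmx W -> Y *m W = Z *m W.
Proof.
move=> eqYZ; apply/eqP; rewrite -subr_eq0 -mulmxBl.
by apply/eqP/mulmx_gram_eq0; rewrite !mulmxBl eqYZ subrr.
Qed.

(** The trace of D^* (H D + D H) is a sum of two squared Frobenius norms
    (with H = W W^* ), so both vanish. *)
Lemma gram_anticommute (m n : nat) (W : 'M[K]_(m, n)) (D : 'M[K]_m) :
  W *m adjmx W *m D + D *m (W *m adjmx W) = 0 ->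
  adjmx W *m D = 0 /\ D *m W = 0.
Proof.
move=> anti.
have normsE : \tr (adjmx (adjmx W *m D) *m (adjmx W *m D))
            + \tr (adjmx (D *m W) *m (D *m W)) = 0.
  rewrite !adjmxM adjmxK.
  rewrite [X in _ + \tr X](_ : _ = adjmx W *m (adjmx D *m D *m W)); last first.
    by rewrite !mulmxA.
  rewrite [X in _ + X]mxtrace_mulC -linearD /=.
  rewrite -[RHS](mxtrace0 _ m) -[in RHS](mulmx0 _ (adjmx D)) -anti.
  by rewrite mulmxDr !mulmxA.
move/eqP: normsE; rewrite paddr_eq0 ?frobenius_ge0 // => /andP[/eqP n1 /eqP n2].
by split; apply: frobenius_eq0.
Qed.

(** The commutator D of M with H = W W^* anticommutes with H, hence W^* D = 0
    and D W = 0.  Then D^* (M H - H M) has trace zero, as H D^* and D^* H both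
    vanish. *)
Lemma gram_sqr_commute (m n : nat) (W : 'M[K]_(m, n)) (H M : 'M[K]_m) :
  H = W *m adjmx W -> M *m H *m H = H *m H *m M -> M *m H = H *m M.
Proof.
move=> HE commH2; apply/eqP; rewrite -subr_eq0.
have [WD DW] : adjmx W *m (M *m H - H *m M) = 0
            /\ (M *m H - H *m M) *m W = 0.
  apply: gram_anticommute; rewrite -HE mulmxBr mulmxBl !mulmxA commH2.
  by rewrite addrC subrKA subrr.
set D := _ - _ in WD DW *.
have HD : H *m adjmx D = 0.
  by rewrite HE -mulmxA -adjmxM DW adjmx0 mulmx0.
have DH : adjmx D *m H = 0.
  by rewrite HE mulmxA -{1}[W]adjmxK -adjmxM WD adjmx0 mul0mx.
apply/eqP/frobenius_eq0; rewrite {2}/D mulmxBr linearB /= !mulmxA DH mul0mx.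
by rewrite mxtrace0 subr0 mxtrace_mulC mulmxA HD mul0mx mxtrace0.
Qed.

Lemma mem_colspaceP (m n : nat) (V : 'M[K]_(m, n)) (u : 'cV[K]_m) :
  reflect (exists c : 'cV[K]_n, u = V *m c) (u \in colspace V).
Proof.
apply: (iffP idP) => [uV | [c ->]].
  have /subvP/(_ u uV)/memv_imgP[c _ ->] :
      (colspace V <= limg (linfun (mulmx V) : 'Hom('cV[K]_n, 'cV[K]_m)))%VS.
    apply/span_subvP => v /mapP[j _ ->]; rewrite colE.
    by rewrite -[V *m _](lfunE (mulmx V)) memv_img ?memvf.
  by exists c; rewrite lfunE.
have -> : V *m c = \sum_j c j 0 *: col j V.
  apply/matrixP => i l; rewrite (ord1 l) mxE summxE.
  by apply: eq_bigr => j _; rewrite !mxE mulrC.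
apply: rpred_sum => j _; apply: rpredZ; apply: memv_span.
by apply: map_f; rewrite mem_enum.
Qed.

Lemma orthproj_colspaceP (m n : nat) (V : 'M[K]_(m, n)) (P : 'M[K]_m)
    (Z : 'M[K]_(n, m)) :
  P = V *m Z -> adjmx V *m P = adjmx V -> P = orthproj (colspace V).
Proof.
move=> PE VP; apply: orthproj_unique => v; split.
  by apply/mem_colspaceP; exists (Z *m v); rewrite PE mulmxA.
move=> u /mem_colspaceP[c ->].
by rewrite adjmxM -mulmxA mulmxBr mulmxA VP subrr mulmx0.
Qed.

(** The hypotheses give P P^* = Z V^* P^* = Z V^* = P, so P is self-adjoint and
    taking adjoints yields the previous criterion. *)
Lemma orthproj_colspaceP_dual (m n : nat) (V : 'M[K]_(m, n)) (P : 'M[K]_m)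
    (Z : 'M[K]_(m, n)) :
  P = Z *m adjmx V -> P *m V = V -> P = orthproj (colspace V).
Proof.
move=> PE PV.
have VP : adjmx V *m adjmx P = adjmx V by rewrite -adjmxM PV.
have PPa : P *m adjmx P = P by rewrite {1}PE -mulmxA VP -PE.
have Pa : adjmx P = P by rewrite -PPa adjmxM adjmxK.
apply: (@orthproj_colspaceP _ _ V P (adjmx Z)); last by rewrite -{1}Pa.
by rewrite -Pa PE adjmxM adjmxK.
Qed.

(** Although X need not be the Moore-Penrose inverse of W, the matrix X W X is
    an inner inverse of W. *)
Lemma inner_inverse_sqr (m n : nat) (W : 'M[K]_(m, n)) (X : 'M[K]_(n, m)) :
  X *m W *m adjmx W *m W *m X = adjmx W -> W *m X *m W *m X *m W = W.
Proof.
move=> hX; move BE: (W *m X) => B; move HE: (W *m adjmx W) => H.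
have BHB : B *m H *m B = H by rewrite -BE -HE -{2}hX !mulmxA.
have comm : B *m H *m H = H *m (B *m H).
  apply: (gram_sqr_commute (esym HE)).
  (* both sides are (B H)^3 *)
  have sqE : H *m H = B *m H *m B *m H by rewrite BHB.
  by rewrite sqE -[LHS]mulmxA sqE !mulmxA.
have BHW : B *m (H *m W) = H *m (B *m W).
  rewrite !mulmxA; apply: mulmx_gramI.
  by rewrite -!mulmxA HE !mulmxA comm !mulmxA.
have BBHW : B *m B *m H *m W = H *m W.
  by rewrite -!mulmxA BHW -[in RHS]BHB -!mulmxA.
(* cancel the factor W = (W^* )^* first, then W^* *)
have BBH : B *m B *m W *m adjmx W = 1%:M *m W *m adjmx W.
  rewrite mul1mx; apply: (@mulmx_gramI _ _ _ (adjmx W)).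
  by rewrite adjmxK HE -BBHW -HE !mulmxA.
by have := mulmx_gramI BBH; rewrite mul1mx -BE !mulmxA.
Qed.

End AdjointCalculus.

Theorem corollary5p3 (R : realType) (k : scalar_kind) (m n : nat)
    (W : 'M[scalars R k]_(m, n)) (X : 'M[scalars R k]_(n, m))
    (hX : X *m W *m adjmx W *m W *m X = adjmx W) :
  [/\ (W *m X) ^+ 2 = orthproj (colspace W),
      (X *m W) ^+ 2 = orthproj (colspace (adjmx W)),
      (W *m X) ^+ 3 = W *m X
    & (X *m W) ^+ 3 = X *m W].
Proof.
have WXWXW := inner_inverse_sqr hX.
have B3 : W *m X *m W *m X *m W *m X = W *m X by rewrite WXWXW.
have C3 : X *m W *m X *m W *m X *m W = X *m W.
  by rewrite -[in RHS]WXWXW !mulmxA.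
split; rewrite ?exprS ?expr0 ?mulr1 -?mulmxE ?mulmxA //.
  apply: (@orthproj_colspaceP _ _ _ _ _ _ (X *m W *m X)).
    by rewrite !mulmxA.
  (* W^* = (X W W^* ) (W X), and (W X)^3 = W X *)
  by rewrite -{1}hX -[RHS]hX -!mulmxA; congr (_ *m (_ *m (_ *m _)));
     rewrite !mulmxA B3.
apply: (@orthproj_colspaceP_dual _ _ _ _ _ _ (X *m W *m X)).
  by rewrite adjmxK.
(* W^* = (X W) (W^* W X), and (X W)^3 = X W *)
by rewrite -{1}hX !mulmxA C3 hX.
Qed.
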